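(* Let $p\ge2$ and, for $\tau=1,\dots,p$, let $\hat f_\tau:\mathbb{R}^n\to\mathbb{R}$ be $\mu$-strongly convex and $\hat c_\tau:\mathbb{R}^n\times\mathbb{R}^n\times\mathbb{R}^r\to\mathbb{R}$ be convex and $\ell$-strongly smooth, all twice continuously differentiable. For an initial state $\hat x_0\in\mathbb{R}^n$, disturbances $\hat w=(\hat w_0,\dots,\hat w_{p-1})$ with $\hat w_\tau\in\mathbb{R}^r$, and a terminal state $\hat x_p\in\mathbb{R}^n$, let \[\hat\psi(\hat x_0,\hat w,\hat x_p) := \arg\min_{\hat x_{1:p-1}}\sum_{\tau=1}^{p-1}\hat f_\tau(\hat x_\tau) + \sum_{\tau=1}^p\hat c_\tau(\hat x_\tau,\hat x_{\tau-1},\hat w_{\tau-1}),\] indexed by $1,\dots,p-1$. Then for any two tuples $(\hat x_0,\hat w,\hat x_p)$ and $(\hat x_0',\hat w',\hat x_p')$ and all $1\le h\le p-1$, \[\|\hat\psi(\hat x_0,\hat w,\hat x_p)_h - \hat\psi(\hat x_0',\hat w',\hat x_p')_h\| \le C_0\left(\lambda_0^{h-1}\|\hat x_0-\hat x_0'\| + \sum_{\tau=0}^{p-1}\lambda_0^{|h-\tau|-1}\|\hat w_\tau-\hat w_\tau'\| + \lambda_0^{p-h-1}\|\hat x_p-\hat x_p'\|\right),\] where $C_0 = 2\ell/\mu$ and $\lambda_0 = 1 - 2\left(\sqrt{1+2\ell/\mu}+1\right)^{-1}$.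
   Context: Norms are Euclidean. A function $g$ is $\ell$-strongly smooth if $g(y)\le g(x)+\langle\nabla g(x),y-x\rangle+\frac\ell2\|y-x\|^2$ for all $x,y$, and $m$-strongly convex if $g(y)\ge g(x)+\langle\nabla g(x),y-x\rangle+\frac m2\|y-x\|^2$ for all $x,y$. *)

(* Defs.v *)
From HB Require Import structures.
From mathcomp Require Import all_boot all_order all_algebra.
From mathcomp Require Import all_classical all_reals all_analysis.
Set Implicit Arguments. Unset Strict Implicit. Unset Printing Implicit Defensive.
Import Order.TTheory GRing.Theory Num.Theory.
Import numFieldNormedType.Exports.
Local Open Scope ring_scope.

Section Defs.
Context {R : realType}.

(* Euclidean norm on R^k (the library norm on matrices is the max norm). *)
Definition enorm {k : nat} (v : 'rV[R]_k) : R := Num.sqrt (\sum_(i < k) (v 0 i) ^+ 2).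

Definition grad {k : nat} (g : 'rV[R]_k -> R) (x : 'rV[R]_k) : 'rV[R]_k :=
  \row_(i < k) ('d g x (delta_mx 0 i : 'rV[R]_k)).

Definition C2 {k : nat} (g : 'rV[R]_k -> R) : Prop :=
  (forall x, differentiable g x) /\
  (forall x, differentiable (grad g) x) /\
  (forall (i : 'I_k), continuous (fun x => 'd (grad g) x (delta_mx 0 i : 'rV[R]_k))).

Definition strongly_convex {k : nat} (m : R) (g : 'rV[R]_k -> R) : Prop :=
  forall x y, g x + 'd g x (y - x) + m / 2 * enorm (y - x) ^+ 2 <= g y.

Definition strongly_smooth {k : nat} (l : R) (g : 'rV[R]_k -> R) : Prop :=
  forall x y, g y <= g x + 'd g x (y - x) + l / 2 * enorm (y - x) ^+ 2.

Definition convex_fun {k : nat} (g : 'rV[R]_k -> R) : Prop :=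
  forall (x y : 'rV[R]_k) (t : R), 0 <= t <= 1 ->
    g (t *: x + (1 - t) *: y) <= t * g x + (1 - t) * g y.

Definition traj {n : nat} (p : nat) (x0 xp : 'rV[R]_n) (y : nat -> 'rV[R]_n)
  (t : nat) : 'rV[R]_n :=
  if t == 0%N then x0 else if t == p then xp else y t.

Definition objective {n r : nat} (p : nat) (f : nat -> 'rV[R]_n -> R)
  (c : nat -> 'rV[R]_(n + n + r) -> R) (x0 : 'rV[R]_n) (w : nat -> 'rV[R]_r)
  (xp : 'rV[R]_n) (y : nat -> 'rV[R]_n) : R :=
  \sum_(1 <= t < p) f t (traj p x0 xp y t) +
  \sum_(1 <= t < p.+1)
     c t (row_mx (row_mx (traj p x0 xp y t) (traj p x0 xp y t.-1)) (w t.-1)).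

Definition is_argmin {n r : nat} (p : nat) (f : nat -> 'rV[R]_n -> R)
  (c : nat -> 'rV[R]_(n + n + r) -> R) (x0 : 'rV[R]_n) (w : nat -> 'rV[R]_r)
  (xp : 'rV[R]_n) (y : nat -> 'rV[R]_n) : Prop :=
  forall z : nat -> 'rV[R]_n, objective p f c x0 w xp y <= objective p f c x0 w xp z.

End Defs.

(* Main.v *)
(* No averaged Hessian is formed.  Let [D] be the difference of the two optimal
   trajectories, boundary states included.  By cocoercivity the gradient
   difference [g] of each stage cost satisfies [|g|^2 <= l <g, d>] with [d] the
   difference of its arguments, so [g = <G, d> G] for a vector [G] with
   [|G|^2 <= l]; the gradient difference of [f t] is handled in the same way after
   removing [mu D t].  Hence [D] solves a block tridiagonal symmetric positive
   linear system.

   Testing that system with its Green function [phi] at the stage [h], in the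
   direction [D h], expresses [|D h|^2] through the data, and it remains to see
   that [|phi k| <= lam^|h-k| |D h| / mu].  This is a Combes-Thomas estimate: test
   the equation of [phi] with [eta^2 phi], where [eta] is geometric of ratio
   [1/lam] from [h] to [k] and constant elsewhere.  Since
   [(a + b) (s^2 a + t^2 b) = (s a + t b)^2 + (s - t)^2 a b], each link loses at
   most [l/2 (s - t)^2 |phi_t| |phi_(t-1)|], and [lam] is the root of
   [l/2 (1 - lam)^2 = mu lam], the rate at which this loss is still absorbed by the
   diagonal, with constant 1. *)
Require Import Defs.
From HB Require Import structures.
From mathcomp Require Import all_boot all_order all_algebra.
From mathcomp Require Import all_classical all_reals all_analysis.
From mathcomp Require Import ring lra zify.
Import Order.TTheory GRing.Theory Num.Theory.
Import numFieldNormedType.Exports.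
Local Open Scope ring_scope.

Set Implicit Arguments.
Unset Strict Implicit.
Unset Printing Implicit Defensive.

(** * Euclidean geometry of row vectors *)

Section InnerProduct.
Context {R : realType}.

Definition dot {k : nat} (u v : 'rV[R]_k) : R := \sum_(i < k) u 0 i * v 0 i.

Lemma dotC k (u v : 'rV[R]_k) : dot u v = dot v u.
Proof. by apply: eq_bigr => i _; rewrite mulrC. Qed.

Lemma dotDl k (u v w : 'rV[R]_k) : dot (u + v) w = dot u w + dot v w.
Proof.
by rewrite /dot -big_split; apply: eq_bigr => i _; rewrite mxE mulrDl.
Qed.

Lemma dotZl k a (u w : 'rV[R]_k) : dot (a *: u) w = a * dot u w.
Proof. by rewrite /dot mulr_sumr; apply: eq_bigr => i _; rewrite mxE mulrA. Qed.

Lemma dotDr k (u v w : 'rV[R]_k) : dot u (v + w) = dot u v + dot u w.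
Proof. by rewrite !(dotC u) dotDl. Qed.

Lemma dotZr k a (u w : 'rV[R]_k) : dot u (a *: w) = a * dot u w.
Proof. by rewrite !(dotC u) dotZl. Qed.

Lemma dotNl k (u w : 'rV[R]_k) : dot (- u) w = - dot u w.
Proof. by rewrite -scaleN1r dotZl mulN1r. Qed.

Lemma dotNr k (u w : 'rV[R]_k) : dot u (- w) = - dot u w.
Proof. by rewrite !(dotC u) dotNl. Qed.

Lemma dotBl k (u v w : 'rV[R]_k) : dot (u - v) w = dot u w - dot v w.
Proof. by rewrite dotDl dotNl. Qed.

Lemma dot0l k (u : 'rV[R]_k) : dot 0 u = 0.
Proof. by rewrite -(scale0r 0) dotZl mul0r. Qed.

Lemma dot0r k (u : 'rV[R]_k) : dot u 0 = 0.
Proof. by rewrite dotC dot0l. Qed.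

Definition dotE := (dotDl, dotDr, dotNl, dotNr, dotZl, dotZr, @dot0l, @dot0r).

Lemma dot_row_mx k m (u v : 'rV[R]_k) (u' v' : 'rV[R]_m) :
  dot (row_mx u u') (row_mx v v') = dot u v + dot u' v'.
Proof.
rewrite /dot big_split_ord /=; congr (_ + _); apply: eq_bigr => i _;
by rewrite ?row_mxEl ?row_mxEr.
Qed.

Lemma dot_ge0 k (u : 'rV[R]_k) : 0 <= dot u u.
Proof. by apply: sumr_ge0 => i _; rewrite -expr2 sqr_ge0. Qed.

Lemma dot_eq0 k (u : 'rV[R]_k) : dot u u = 0 -> u = 0.
Proof.
move=> /eqP; rewrite psumr_eq0; last by move=> i _; rewrite -expr2 sqr_ge0.
move=> /allP u0; apply/rowP => i; rewrite mxE.
by have /eqP := u0 i (mem_index_enum i); rewrite -expr2 => /eqP; rewrite sqrf_eq0 => /eqP.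
Qed.

Lemma enormE k (u : 'rV[R]_k) : enorm u = Num.sqrt (dot u u).
Proof. by congr Num.sqrt; apply: eq_bigr => i _; rewrite expr2. Qed.

Lemma enorm_sqr k (u : 'rV[R]_k) : enorm u ^+ 2 = dot u u.
Proof. by rewrite enormE sqr_sqrtr ?dot_ge0. Qed.

Lemma enorm_ge0 k (u : 'rV[R]_k) : 0 <= enorm u.
Proof. exact: sqrtr_ge0. Qed.

Lemma enorm0 k : enorm (0 : 'rV[R]_k) = 0.
Proof. by rewrite enormE dot0l sqrtr0. Qed.

Lemma cauchy_schwarz k (u v : 'rV[R]_k) : `|dot u v| <= enorm u * enorm v.
Proof.
rewrite -ler_sqr ?nnegrE ?mulr_ge0 ?enorm_ge0 //.
rewrite real_normK ?num_real // exprMn !enorm_sqr.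
have [v0|v0] := eqVneq (dot v v) 0; first by rewrite (dot_eq0 v0) !dot0r expr0n mulr0.
have vp : 0 < dot v v by rewrite lt_def v0 dot_ge0.
have := dot_ge0 (dot v v *: u - dot u v *: v).
rewrite !dotE (dotC v u); set a := dot u u; set b := dot u v; set c := dot v v.
move=> H; have : 0 <= c * (a * c - b ^+ 2) by move: H; congr (0 <= _); ring.
by rewrite pmulr_rge0 // subr_ge0.
Qed.

Lemma linear_dot k (L : 'rV[R]_k -> R) :
  (forall a u v, L (a *: u + v) = a * L u + L v) ->
  forall v, L v = dot (\row_i L (delta_mx 0 i)) v.
Proof.
move=> Llin v.
have L0 : L 0 = 0 by have := Llin (-1) 0 0; rewrite scaler0 addr0; lra.
rewrite [in LHS](row_sum_delta v) /dot.
elim/big_rec2: _ => [//|i y1 y2 _ <-]; rewrite Llin mxE; ring.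
Qed.

Lemma dot_inj k (u v : 'rV[R]_k) : (forall w, dot u w = dot v w) -> u = v.
Proof.
move=> uv; apply/eqP; rewrite -subr_eq0; apply/eqP/dot_eq0.
by rewrite dotDl uv dotNl subrr.
Qed.

(** In finite dimension, definiteness makes the matrix of the form injective, hence invertible. This
    will produce the Green function. *)
Lemma lax_milgram k (a : 'rV[R]_k -> 'rV[R]_k -> R)
    (L : 'rV[R]_k -> R) :
  (forall s x y z, a (s *: x + y) z = s * a x z + a y z) ->
  (forall s x y z, a z (s *: x + y) = s * a z x + a z y) ->
  (forall x, a x x = 0 -> x = 0) ->
  (forall s x y, L (s *: x + y) = s * L x + L y) ->
  exists x, forall y, a x y = L y.
Proof.
move=> al ar a0 Ll.
pose M : 'M[R]_k := \matrix_(i, j) a (delta_mx 0 i) (delta_mx 0 j).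
have aM x y : a x y = dot (x *m M) y.
  rewrite (linear_dot (fun s u v => ar s u v x)); congr dot.
  apply/rowP => j; rewrite !mxE (@linear_dot _ (fun x => a x _)); last by move=> *; rewrite al.
  by apply: eq_bigr => i _; rewrite !mxE mulrC.
have Mfree : row_free M.
  by apply: inj_row_free => v vM0; apply: a0; rewrite aM vM0 dot0l.
have Mu : M \in unitmx by rewrite -row_free_unit.
exists ((\row_j L (delta_mx 0 j)) *m invmx M) => y.
by rewrite aM mulmxKV // -linear_dot.
Qed.

(* A monotone pair (g, d) is matched by the rank-one positive operator
   [dot G _ *: G]; this plays the role of an averaged Hessian.  When
   [dot g d = 0] the junk value [0^-1 = 0] gives [G = 0]. *)
Definition rank1 {k : nat} (g d : 'rV[R]_k) : 'rV[R]_k :=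
  (Num.sqrt (dot g d))^-1 *: g.

Lemma rank1_dot k (g d : 'rV[R]_k) : 0 <= dot g d ->
  (dot g d = 0 -> g = 0) -> dot (rank1 g d) d *: rank1 g d = g.
Proof.
rewrite /rank1 le_eqVlt => /predU1P[/esym gd0 /(_ gd0) ->|gd0 _].
  by rewrite !scaler0.
rewrite scalerA dotZl mulrAC -expr2 exprVn sqr_sqrtr ?ltW // mulVf ?gt_eqF //.
by rewrite scale1r.
Qed.

(** When [<g, d> > 0], [|G|^2 = |g|^2 / <g, d>], so the bound is cocoercivity divided by
    [<g, d>]. *)
Lemma rank1_le k l (g d : 'rV[R]_k) : 0 <= l -> 0 <= dot g d ->
  dot g g <= l * dot g d -> dot (rank1 g d) (rank1 g d) <= l.
Proof.
rewrite /rank1 => l0; rewrite le_eqVlt => /predU1P[<-|gd0].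
  by rewrite sqrtr0 invr0 scale0r dot0l.
rewrite dotZl dotZr mulrA -expr2 exprVn sqr_sqrtr ?(ltW gd0) // => H.
by rewrite mulrC ler_pdivrMr.
Qed.

End InnerProduct.

(** * Gradients of strongly convex functions and of convex smooth ones *)

Section Gradients.
Context {R : realType}.

(** Adds two inequalities with nonlinear terms; the third premise is then an identity for [ring] or
    [field]. *)
Lemma ler_subDD (a b c d x y : R) :
  a <= b -> c <= d -> y - x = (b - a) + (d - c) -> x <= y.
Proof. by rewrite -(subr_ge0 a) -(subr_ge0 c) -(subr_ge0 x) => ab cd ->; exact: addr_ge0. Qed.

Lemma diff_grad k (g : 'rV[R]_k -> R) x v :
  differentiable g x -> 'd g x v = dot (grad g x) v.
Proof.
by move=> dg; rewrite (@linear_dot _ _ ('d g x)) // => a u w; rewrite linearP.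
Qed.

Lemma is_derive_line k (g : 'rV[R]_k -> R) x v (s : R) :
  differentiable g (x + s *: v) ->
  is_derive s (1 : R) (fun t => g (x + t *: v)) (dot (grad g (x + s *: v)) v).
Proof.
move=> dg; rewrite -diff_grad // -deriveE //.
have E : (fun h : R => h^-1 *: (g (x + (h *: 1 + s) *: v) - g (x + s *: v))) =
         (fun h : R => h^-1 *: (g (h *: v + (x + s *: v)) - g (x + s *: v))).
  apply/funext => h; congr (_ *: (g _ - _)).
  by rewrite scalerDl [h *: 1]mulr1 addrCA.
apply: DeriveDef.
  by rewrite /derivable /= E; apply: diff_derivable.
by rewrite /derive /= E.
Qed.

Lemma is_derive_min (F : R -> R) (F' : R -> R) :
  (forall s, is_derive s (1 : R) F (F' s)) -> (forall s, F 0 <= F s) -> F' 0 = 0.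
Proof.
move=> dF F0.
have [_ <-] := dF 0.
apply: derive_val; apply: (@derive1_at_min _ _ (-1) 1) => //.
by rewrite in_itv /= ltrN10 ltr01.
Qed.

(** Along each line through [x], [g] minus its affine minorant is minimal at [x], so its derivative
    vanishes there. *)
Lemma grad_supporting k (g : 'rV[R]_k -> R) x u :
  (forall z, differentiable g z) ->
  (forall v, g x + dot u v <= g (x + v)) -> grad g x = u.
Proof.
move=> dg ux; apply: dot_inj => v.
pose F : R -> R := (fun s : R => g (x + s *: v)) - (dot u v \*: @id R).
have dF s : is_derive s (1 : R) F (dot (grad g (x + s *: v)) v - dot u v *: 1).
  by apply: is_deriveB; exact: is_derive_line.
have := is_derive_min dF; rewrite scale0r addr0 [_ *: 1]mulr1 => H.
apply/eqP; rewrite -subr_eq0; apply/eqP/H => s.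
rewrite /F !fctE /= scale0r addr0 [_ *: 0]mulr0 subr0 lerBrDr.
by rewrite [_ *: s]mulrC -dotZr.
Qed.

(** [e] is the gradient difference of the convex function [g - mu/2 |.|^2]. Its pairing with [x - y]
    is the sum of the gaps [A] and [B] in the two strong convexity inequalities between [x] and [y].
    The equality case is what [rank1_dot] asks for. *)
Lemma strongly_convex_grad k (g : 'rV[R]_k -> R) mu (x y : 'rV[R]_k)
    (e := grad g x - grad g y - mu *: (x - y)) :
  (forall z, differentiable g z) -> 0 < mu -> strongly_convex mu g ->
  0 <= dot e (x - y) /\ (dot e (x - y) = 0 -> e = 0).
Proof.
move=> dg mu0 cvx.
have scv u v : g u + dot (grad g u) (v - u) + mu / 2 * dot (v - u) (v - u) <= g v.
  by have := cvx u v; rewrite diff_grad // enorm_sqr.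
pose A := g x - (g y + dot (grad g y) (x - y) + mu / 2 * dot (x - y) (x - y)).
pose B := g y - (g x + dot (grad g x) (y - x) + mu / 2 * dot (y - x) (y - x)).
have A0 : 0 <= A by rewrite subr_ge0 scv.
have B0 : 0 <= B by rewrite subr_ge0 scv.
have -> : dot e (x - y) = A + B.
  rewrite /A /B -(opprB x y) /e; move: (x - y) (grad g x) (grad g y) => d u v.
  by rewrite !dotE; field.
split; first exact: addr_ge0.
move=> /eqP; rewrite paddr_eq0 // => /andP[_]; rewrite subr_eq0 => /eqP gyE.
(* The lower bounds at [x] and [y] are both attained, so [g] minus its
   quadratic lower bound at [x] is minimal at [y]. *)
have gyv : grad g y = grad g x + mu *: (y - x).
  apply: grad_supporting => // v.
  apply: le_trans (scv x (y + v)); rewrite gyE (addrAC y v).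
  move: (y - x) => d; rewrite !dotE (dotC v) -subr_ge0.
  have := mulr_ge0 (ltW (divr_gt0 mu0 (ltr0Sn R 1))) (dot_ge0 v).
  by congr (0 <= _); field.
by rewrite /e gyv -(opprB x y) scalerN opprD opprK addrA subrr add0r subrr.
Qed.

(** [x] is a convex combination of [y] and of the point [x - t d] slightly behind it, where
    smoothness bounds [g] up to an error of order [t^2]. After division by [t] the error is at most
    [e]. *)
Lemma convex_smooth_above k (g : 'rV[R]_k -> R) l (x y : 'rV[R]_k) :
  (forall z, differentiable g z) -> convex_fun g -> strongly_smooth l g ->
  g x + dot (grad g x) (y - x) <= g y.
Proof.
move=> dg cvx smooth; set d := y - x.
apply/ler_addgt0Pr => e e0.
(* The absolute value keeps [K] nonnegative also for the negative [l] treated later. *)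
pose K := `|l| / 2 * dot d d.
have K0 : 0 <= K by rewrite mulr_ge0 ?divr_ge0 ?dot_ge0.
have lK : l / 2 * dot d d <= K by rewrite ler_wpM2r ?dot_ge0 // ler_pM2r ?ler_norm.
pose t := e / (K + 1).
have t0 : 0 < t by rewrite divr_gt0 //; lra.
have tK : t * K <= e.
  have : t * (K + 1) = e by rewrite /t; field; lra.
  lra.
have t1 : 0 < 1 + t by lra.
have := cvx (x - t *: d) y (1 + t)^-1.
have -> : (1 + t)^-1 *: (x - t *: d) + (1 - (1 + t)^-1) *: y = x.
  by apply/rowP => i; rewrite !mxE; field; lra.
rewrite invr_ge0 ltW //= invf_le1 // lerDl ltW // => /(_ isT).
rewrite -(ler_pM2l t1) mulrDr !mulrA divff ?gt_eqF // mul1r.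
have -> : (1 + t) * (1 - (1 + t)^-1) = t by field; lra.
have := smooth x (x - t *: d); rewrite (addrAC x _ (- x)) subrr add0r diff_grad // enorm_sqr !(dotNl, dotNr, dotZl, dotZr).
set b := g (x - t *: d) => H1 H2.
have H3 : t * (t * (l / 2 * dot d d)) <= t * e.
  by rewrite ler_pM2l // (le_trans _ tK) // ler_pM2l.
rewrite -(ler_pM2l t0); by apply: (ler_subDD (lerD H1 H2) H3); field.
Qed.

(** Baillon-Haddad: at [u - t w], a gradient step from [u], compare the quadratic upper bound at [u]
    with the tangent at [v]. Adding the results for [(x, y)] and [(y, x)] gives [main]. *)
Lemma cocoercive k (g : 'rV[R]_k -> R) l (x y : 'rV[R]_k) :
  (forall z, differentiable g z) -> 0 <= l -> convex_fun g -> strongly_smooth l g ->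
  dot (grad g x - grad g y) (grad g x - grad g y) <=
    l * dot (grad g x - grad g y) (x - y).
Proof.
move=> dg l0 cvx smooth.
have bregman t u v w : w = grad g u - grad g v ->
    (t - l / 2 * t ^+ 2) * dot w w <= g u - g v - dot (grad g v) (u - v).
  move=> wE; have ww : dot w w = dot (grad g u) w - dot (grad g v) w.
    by rewrite {1}wE dotBl.
  have := convex_smooth_above v (u - t *: w) dg cvx smooth.
  have := smooth u (u - t *: w).
  rewrite (addrAC u _ (- u)) subrr add0r (addrAC u _ (- v)) diff_grad // enorm_sqr.
  move: (u - v) (grad g u) (grad g v) ww (g (u - t *: w)) {wE} => d gu gv ww b.
  rewrite (dotDr gv) !(dotNl, dotNr, dotZl, dotZr).
  by move=> H1 H2; apply: (ler_subDD H1 H2); rewrite mulrBl {1}ww; ring.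
have [w wE] : exists w, w = grad g x - grad g y by exists (grad g x - grad g y).
rewrite -wE; have w0 := dot_ge0 w.
have main t : (2 * t - l * t ^+ 2) * dot w w <= dot w (x - y).
  have := bregman t y x (- w); rewrite {1}wE opprB => /(_ erefl).
  rewrite -(opprB x y) !(dotNl, dotNr).
  have := bregman t x y w wE; move: (x - y) (grad g x) (grad g y) wE => d gx gy wE.
  have -> : dot w d = dot gx d - dot gy d by rewrite wE dotBl.
  by move=> H1 H2; apply: (ler_subDD H1 H2); field.
move: l0; rewrite le_eqVlt => /predU1P[l0|l0].
  rewrite -l0 mul0r leNgt; apply/negP => wp.
  (* With [l = 0] this [t] gives [<w, x - y> <= -2], against [t = 0]. *)
  have := main ((dot w (x - y) + 1) / dot w w); rewrite -l0 mul0r subr0 -mulrA divfK ?gt_eqF //.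
  have := main 0; rewrite mulr0 expr0n mulr0 subrr mul0r.
  by move: (dot w (x - y)) => a a0 a1; clear -a0 a1; lra.
(* [t = 1/l] maximises [2 t - l t^2]. *)
have := main l^-1; rewrite (_ : 2 * l^-1 - _ = l^-1); last by field; rewrite gt_eqF.
by rewrite mulrC ler_pdivrMr // mulrC.
Qed.

(** The function lies above its tangent at [0] and, for [l < 0], strictly below it away from [0]:
    the space is trivial. *)
Lemma neg_smooth_enorm0 k (g : 'rV[R]_k -> R) l (x : 'rV[R]_k) :
  (forall z, differentiable g z) -> l < 0 -> convex_fun g -> strongly_smooth l g ->
  enorm x = 0.
Proof.
move=> dg l0 cvx smooth.
have := convex_smooth_above 0 x dg cvx smooth.
have := smooth 0 x; rewrite diff_grad // subr0 => H1 H2.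
apply/eqP; rewrite -sqrf_eq0; apply/eqP.
have := le_trans H2 H1; rewrite lerDl nmulr_rge0; last by rewrite pmulr_llt0.
by move=> x0; apply/le_anti; rewrite x0 sqr_ge0.
Qed.

End Gradients.

(** * The block tridiagonal system as a bilinear form, and its Green function *)

Section Energy.
Context {R : realType} {n : nat}.
Implicit Types E P Q phi psi : nat -> 'rV[R]_n.

(** The averaged Hessian is replaced by [mu] plus the rank-one term of [E t] at each interior stage,
    and by the rank-one term of [(P t, Q t)] on the link from [t.-1] to [t]. *)
Definition energy (p : nat) (mu : R) E P Q phi psi : R :=
  \sum_(1 <= t < p) (mu * dot (phi t) (psi t) + dot (E t) (phi t) * dot (E t) (psi t)) +
  \sum_(1 <= t < p.+1)
     (dot (P t) (phi t) + dot (Q t) (phi t.-1)) *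
     (dot (P t) (psi t) + dot (Q t) (psi t.-1)).

Lemma energyC p mu E P Q phi psi :
  energy p mu E P Q phi psi = energy p mu E P Q psi phi.
Proof.
by congr (_ + _); apply: eq_bigr => t _; rewrite mulrC // dotC mulrC [in X in _ + X]mulrC.
Qed.

Lemma energy_linear p mu E P Q (s : R) phi1 phi2 phi psi :
  (forall t, phi t = s *: phi1 t + phi2 t) ->
  energy p mu E P Q phi psi = s * energy p mu E P Q phi1 psi + energy p mu E P Q phi2 psi.
Proof.
move=> phiE; rewrite /energy mulrDr addrACA !mulr_sumr -!big_split /=.
by congr (_ + _); apply: eq_bigr => t _; rewrite !phiE !dotE; ring.
Qed.

Lemma eq_energy p mu E P Q phi psi psi' :
  (forall t, (t <= p)%N -> psi t = psi' t) ->
  energy p mu E P Q phi psi = energy p mu E P Q phi psi'.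
Proof.
move=> eq_psi; congr (_ + _); apply: eq_big_nat => t /andP[t0 tp].
  by rewrite eq_psi // ltnW.
by rewrite !eq_psi // (leq_trans (leq_pred t)).
Qed.

Lemma energy_eq0 p mu E P Q phi t : 0 < mu -> (1 <= t < p)%N ->
  energy p mu E P Q phi phi = 0 -> phi t = 0.
Proof.
move=> mu0 tp /eqP; rewrite paddr_eq0; first last.
- by apply: sumr_ge0 => i _; rewrite -expr2 sqr_ge0.
- by apply: sumr_ge0 => i _; rewrite addr_ge0 -?expr2 ?sqr_ge0 ?mulr_ge0 ?dot_ge0 ?(ltW mu0).
case/andP; rewrite psumr_eq0; last first.
  by move=> i _; rewrite addr_ge0 -?expr2 ?sqr_ge0 ?mulr_ge0 ?dot_ge0 ?(ltW mu0).
move=> /allP /(_ t); rewrite mem_index_iota => /(_ tp) /= + _.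
rewrite paddr_eq0 -?expr2 ?sqr_ge0 ?mulr_ge0 ?dot_ge0 ?(ltW mu0) //.
by rewrite mulf_eq0 gt_eqF //= => /andP[/eqP /dot_eq0].
Qed.

Lemma green_function p mu E P Q h (u : 'rV[R]_n) : (2 <= p)%N -> 0 < mu ->
  exists phi, [/\ phi 0%N = 0, phi p = 0 &
    forall psi, psi 0%N = 0 -> psi p = 0 -> (h <= p)%N ->
      energy p mu E P Q phi psi = dot u (psi h)].
Proof.
case: p => [//|[//|q]] _ mu0; set p := q.+2.
(* Interior states [1, ..., q.+1] are stored as rows [0, ..., q] of a matrix, flattened so that
   [lax_milgram] applies; both ends are set to zero. *)
pose ext (x : 'rV[R]_(q.+1 * n)) : nat -> 'rV[R]_n :=
  traj p 0 0 (fun t => row (inord t.-1) (vec_mx x)).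
have extE s x y t : ext (s *: x + y) t = s *: ext x t + ext y t.
  by rewrite /ext /traj; do 2?case: ifP => _; rewrite ?scaler0 ?addr0 // !linearP.
have [x xE] : exists x, forall y, energy p mu E P Q (ext x) (ext y) = dot u (ext y h).
  apply: (lax_milgram (a := fun x y => energy p mu E P Q (ext x) (ext y))
    (L := fun y => dot u (ext y h))).
  - by move=> s x y z; exact: energy_linear.
  - by move=> s x y z; rewrite !(energyC _ _ _ _ _ (ext z)); exact: energy_linear.
  - move=> x x0; apply: (can_inj vec_mxK); rewrite linear0; apply/row_matrixP => i.
    have := energy_eq0 (p := p) (t := i.+1) mu0 (ltn_ord i) x0.
    by rewrite /ext /traj /= eqSS ltn_eqF // inord_val => ->; rewrite row0.
  - by move=> s x y; rewrite extE dotDr dotZr.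
exists (ext x); split => //; first by rewrite /ext /traj eqxx.
move=> psi psi0 psip hp.
pose y := mxvec (\matrix_(i < q.+1, j < n) psi i.+1 0 j).
have extyE t : (t <= p)%N -> psi t = ext y t.
  rewrite /ext /traj; case: t => [//|t] tp /=; case: eqP => [-> //|/eqP tp'].
  by apply/rowP => j; rewrite mxvecK !mxE inordK // -ltnS ltn_neqAle tp' tp.
by rewrite (eq_energy _ _ _ _ _ extyE) xE extyE.
Qed.

End Energy.

(** * Exponential decay of the Green function *)

Section Decay.
Context {R : realType} {n : nat}.
Implicit Types E P Q phi psi : nat -> 'rV[R]_n.

Lemma enorm_mul_le k m (l : R) (u : 'rV[R]_k) (v : 'rV[R]_m) :
  dot u u + dot v v <= l -> enorm u * enorm v <= l / 2.
Proof.
rewrite -!enorm_sqr; move: (enorm u) (enorm v) => a b H.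
by have := sqr_ge0 (a - b); rewrite sqrrB; lra.
Qed.

Lemma weighted_link (l a b : R) (P Q x y : 'rV[R]_n) :
  dot P P + dot Q Q <= l ->
  - (l / 2 * (a - b) ^+ 2 * (enorm x * enorm y)) <=
    (dot P x + dot Q y) * (a ^+ 2 * dot P x + b ^+ 2 * dot Q y).
Proof.
move=> PQ.
have PQxy : - (l / 2 * (enorm x * enorm y)) <= dot P x * dot Q y.
  apply: le_trans (lerNnormlW (lexx _)); rewrite lerN2 normrM.
  apply: le_trans (ler_pM _ _ (cauchy_schwarz _ _) (cauchy_schwarz _ _)) _ => //.
  by rewrite mulrACA ler_wpM2r ?mulr_ge0 ?enorm_ge0 ?enorm_mul_le.
have := ler_wpM2l (sqr_ge0 (a - b)) PQxy.
have := sqr_ge0 (a * dot P x + b * dot Q y).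
move: (enorm x) (enorm y) (dot P x) (dot Q y) => X Y p q H1 H2.
by apply: (ler_subDD H1 H2); ring.
Qed.

(** The difference of the two sides is half the sum of the squares [(Z t - Z t.-1)^2]. *)
Lemma sum_sqr_sub_cross (Z : nat -> R) a m :
  (Z a ^+ 2 + Z (a + m)%N ^+ 2) / 2 <=
  \sum_(a <= t < (a + m).+1) Z t ^+ 2 - \sum_(a.+1 <= t < (a + m).+1) Z t * Z t.-1.
Proof.
elim: m => [|m IH]; first by rewrite addn0 big_nat1 big_geq //; lra.
rewrite addnS !(@big_nat_recr _ _ _ (a + m).+1) /= ?ltnS ?leq_addr //; last by rewrite leqW ?leq_addr.
move: IH; move: (\sum_(_ <= _ < _) _) (\sum_(_ <= _ < _) _) => A B.
have := sqr_ge0 (Z (a + m)%N - Z (a + m).+1); rewrite sqrrB.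
move: (Z a) (Z _) (Z _) => x y z; lra.
Qed.

Context (p : nat) (mu l : R) (E P Q phi : nat -> 'rV[R]_n) (h : nat) (u : 'rV[R]_n)
  (mu0 : 0 < mu)
  (PQl : forall t, (1 <= t <= p)%N -> dot (P t) (P t) + dot (Q t) (Q t) <= l)
  (phi0 : phi 0%N = 0) (phip : phi p = 0)
  (phiE : forall psi, psi 0%N = 0 -> psi p = 0 ->
     energy p mu E P Q phi psi = dot u (psi h)).

(** Completing the square gives [(m x - c)^2 + (m y)^2 <= c^2]. This keeps the constant of the decay
    estimate equal to 1. *)
Lemma le_of_quadratic (m c x y : R) : 0 < m -> 0 <= c ->
  m * (x ^+ 2 + y ^+ 2) <= 2 * c * x -> y <= c / m.
Proof.
move=> m0 c0 H; rewrite ler_pdivlMr // mulrC.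
have [y0|y0] := leP 0 y; last by rewrite (le_trans _ c0) // pmulr_rle0 // ltW.
rewrite -ler_sqr ?nnegrE ?mulr_ge0 ?(ltW m0) //.
have := ler_wpM2l (ltW m0) H; have := sqr_ge0 (m * x - c) => H1 H2.
by apply: (ler_subDD H1 H2); ring.
Qed.

(** The test sequence [eta^2 phi] vanishes at both ends with [phi]; the nonnegative [E] terms are
    dropped. *)
Lemma weighted_energy_le (eta : nat -> R) :
  \sum_(1 <= t < p) mu * (eta t * enorm (phi t)) ^+ 2 <=
  \sum_(1 <= t < p.+1)
     l / 2 * (eta t - eta t.-1) ^+ 2 * (enorm (phi t) * enorm (phi t.-1)) +
  eta h ^+ 2 * (enorm u * enorm (phi h)).
Proof.
have uh : eta h ^+ 2 * dot u (phi h) <= eta h ^+ 2 * (enorm u * enorm (phi h)).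
  by rewrite ler_wpM2l ?sqr_ge0 // (le_trans (ler_norm _)) ?cauchy_schwarz.
rewrite addrC -lerBlDr; apply: le_trans uh; rewrite -dotZr.
rewrite -(@phiE (fun t => eta t ^+ 2 *: phi t)) ?phi0 ?phip ?scaler0 //.
rewrite /energy -sumrN; apply: lerD; apply: ler_sum_nat => t tp.
  rewrite exprMn enorm_sqr !dotZr -subr_ge0.
  have := mulr_ge0 (sqr_ge0 (eta t)) (sqr_ge0 (dot (E t) (phi t))).
  by congr (0 <= _); ring.
by rewrite !dotZr weighted_link ?PQl.
Qed.

(** Links outside [(a, b]] cost nothing since [eta] is constant across them; those inside are
    dominated by the cross terms of [sum_sqr_sub_cross]. The factor 2 on the right clears its
    halves. *)
Lemma weighted_ends_le (eta : nat -> R) a b :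
  (1 <= a)%N -> (a <= b)%N -> (b < p)%N ->
  (forall t, 0 <= eta t) ->
  (forall t, (a < t <= b)%N -> l / 2 * (eta t - eta t.-1) ^+ 2 <= mu * (eta t * eta t.-1)) ->
  (forall t, (1 <= t)%N -> ~~ (a < t <= b)%N -> eta t = eta t.-1) ->
  mu * ((eta a * enorm (phi a)) ^+ 2 + (eta b * enorm (phi b)) ^+ 2) <=
    2 * eta h * enorm u * (eta h * enorm (phi h)).
Proof.
move=> a1 ab bp eta0 etain etaout.
pose Z t := eta t * enorm (phi t).
have H := weighted_energy_le eta.
have L : \sum_(a <= t < b.+1) mu * Z t ^+ 2 <= \sum_(1 <= t < p) mu * Z t ^+ 2.
  rewrite (big_cat_nat a1 (ltnW (leq_ltn_trans ab bp))) /=.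
  rewrite (@big_cat_nat _ _ _ b.+1 a p) ?(leqW ab) //= addrCA lerDl.
  by rewrite addr_ge0 // sumr_ge0 // => i _; rewrite mulr_ge0 ?sqr_ge0 ?(ltW mu0).
have U : \sum_(1 <= t < p.+1)
     l / 2 * (eta t - eta t.-1) ^+ 2 * (enorm (phi t) * enorm (phi t.-1)) <=
     \sum_(a.+1 <= t < b.+1) mu * (Z t * Z t.-1).
  rewrite (@big_cat_nat _ _ _ a.+1 1) ?ltnS ?(ltnW (leq_ltn_trans ab bp)) //=.
  rewrite (@big_cat_nat _ _ _ b.+1 a.+1) ?ltnS ?(ltnW bp) //=.
  rewrite big_nat big1 ?add0r; last first.
    move=> t /andP[t1 ta]; rewrite -etaout ?subrr ?expr0n ?mulr0 ?mul0r //.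
    by rewrite negb_and -leqNgt -ltnS ta.
  rewrite [X in _ + X]big_nat [X in _ + X]big1 ?addr0; last first.
    move=> t /andP[tb _]; rewrite -etaout ?subrr ?expr0n ?mulr0 ?mul0r //.
      exact: leq_ltn_trans tb.
    by rewrite negb_and -(ltnNge b t) tb orbT.
  apply: ler_sum_nat => t /andP[at_ tb].
  rewrite /Z (mulrACA (eta t)) (mulrA mu) ler_wpM2r ?mulr_ge0 ?enorm_ge0 ?etain //.
  by rewrite at_ -ltnS.
have := sum_sqr_sub_cross Z a (b - a); rewrite subnKC // => /(ler_wpM2l (ltW mu0)).
rewrite mulrBr !mulr_sumr.
move: L H U; rewrite /Z.
move: (\sum_(a <= t < b.+1) _) (\sum_(1 <= t < p) _) (\sum_(1 <= t < p.+1) _)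
  (\sum_(a.+1 <= t < b.+1) _) => A B C D.
move: (enorm _) (enorm _) (enorm _) (enorm _) => X1 X2 X3 X4.
move: (eta a) (eta b) (eta h) => e1 e2 e3.
lra.
Qed.

(* The weight [eta] grows geometrically from [h] to [k] and is constant
   elsewhere.  At the rate [lam] the links between [h] and [k] cost
   exactly [mu * Z t * Z t.-1], which the diagonal still absorbs up to half of
   the two end terms. *)
Lemma green_decay (lam : R) (k : nat) :
  0 <= lam -> l / 2 * (1 - lam) ^+ 2 = mu * lam ->
  (1 <= h < p)%N -> (1 <= k < p)%N ->
  enorm (phi k) <= lam ^+ (k - h + (h - k)) * enorm u / mu.
Proof.
move=> lam0 lamE /andP[h1 hp] /andP[k1 kp].
have link m : l / 2 * (lam ^+ m - lam ^+ m.+1) ^+ 2 = mu * (lam ^+ m * lam ^+ m.+1).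
  have -> : l / 2 * (lam ^+ m - lam ^+ m.+1) ^+ 2 =
            lam ^+ m ^+ 2 * (l / 2 * (1 - lam) ^+ 2) by rewrite [lam ^+ m.+1]exprS; ring.
  by rewrite lamE [lam ^+ m.+1]exprS; ring.
have [hk|/ltnW kh] := leqP h k.
(* [maxn] freezes the weight before [h], truncated subtraction after [k]. *)
- pose eta t := lam ^+ (k - maxn h t).
  have etak : eta k = 1 by rewrite /eta (maxn_idPr hk) subnn.
  have etah : eta h = lam ^+ (k - h + (h - k)).
    by rewrite /eta maxnn (eqP hk) addn0.
  have := @weighted_ends_le eta h k h1 hk kp.
  rewrite etak mul1r etah; set c := lam ^+ _ => H.
  apply: (@le_of_quadratic _ _ (c * enorm (phi h))) => //.
    by rewrite mulr_ge0 ?enorm_ge0 ?exprn_ge0.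
  rewrite (mulrA 2); apply: H => t.
  + by rewrite exprn_ge0.
  + move=> /andP[ht tk]; rewrite /eta (maxn_idPr (ltnW ht)).
    have -> : (k - maxn h t.-1 = (k - t).+1)%N by lia.
    by rewrite link.
  + by move=> t1 tout; congr (_ ^+ _); lia.
(* Mirror image: the weight now decreases along a link, whence the sign change before [link]. *)
- pose eta t := lam ^+ (minn h t - k).
  have etak : eta k = 1 by rewrite /eta (minn_idPr kh) subnn.
  have etah : eta h = lam ^+ (k - h + (h - k)).
    by rewrite /eta minnn (eqP kh) add0n.
  have := @weighted_ends_le eta k h k1 kh hp.
  rewrite etak mul1r addrC etah; set c := lam ^+ _ => H.
  apply: (@le_of_quadratic _ _ (c * enorm (phi h))) => //.
    by rewrite mulr_ge0 ?enorm_ge0 ?exprn_ge0.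
  rewrite (mulrA 2); apply: H => t.
  + by rewrite exprn_ge0.
  + move=> /andP[kt th]; rewrite /eta (minn_idPr th).
    have [-> ->] : (t - k = (t - k).-1.+1)%N /\ (minn h t.-1 - k = (t - k).-1)%N by lia.
    by rewrite -sqrrN opprB link [X in mu * X]mulrC.
  + by move=> t1 tout; congr (_ ^+ _); lia.
Qed.

End Decay.

(** * Sensitivity of the linear system to its data *)

Section LinearSensitivity.
Context {R : realType} {n r : nat}.

(** The exponent in the sum is the distance from [h] to the nearer end of link [t]. Each link
    involves two values of [phi], each with coefficient at most [l/2], whence [l / mu]. *)
Lemma linear_sensitivity (p : nat) (mu l lam : R) (E P Q D : nat -> 'rV[R]_n)
    (W dw : nat -> 'rV[R]_r) (h : nat) :
  0 < mu -> 0 <= lam <= 1 -> l / 2 * (1 - lam) ^+ 2 = mu * lam ->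
  (forall t, (1 <= t <= p)%N ->
     dot (P t) (P t) + dot (Q t) (Q t) + dot (W t) (W t) <= l) ->
  (forall psi, psi 0%N = 0 -> psi p = 0 ->
     energy p mu E P Q D psi +
     \sum_(1 <= t < p.+1) dot (W t) (dw t.-1) *
       (dot (P t) (psi t) + dot (Q t) (psi t.-1)) = 0) ->
  (1 <= h < p)%N ->
  enorm (D h) <= l / mu * (lam ^+ h.-1 * enorm (D 0%N)
    + \sum_(1 <= t < p.+1) lam ^+ (h - t + (t.-1 - h)) * enorm (dw t.-1)
    + lam ^+ (p - h).-1 * enorm (D p)).
Proof.
move=> mu0 /andP[lam0 lam1] lamE bound eqD /andP[h1 hp].
have p2 : (2 <= p)%N by lia.
have PQ t : (1 <= t <= p)%N -> dot (P t) (P t) + dot (Q t) (Q t) <= l.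
  by move=> /bound; apply: le_trans; rewrite lerDl dot_ge0.
have PW t : (1 <= t <= p)%N -> dot (P t) (P t) + dot (W t) (W t) <= l.
  by move=> /bound; apply: le_trans; rewrite lerD2r lerDl dot_ge0.
have QW t : (1 <= t <= p)%N -> dot (Q t) (Q t) + dot (W t) (W t) <= l.
  by move=> /bound; apply: le_trans; rewrite lerD2r lerDr dot_ge0.
have l0 : 0 <= l by apply: le_trans (PQ 1%N _); rewrite ?addr_ge0 ?dot_ge0 //; lia.
have [phi [phi0 phip phiE]] := @green_function _ _ p mu E P Q h (D h) p2 mu0.
pose U := enorm (D h); have U0 : 0 <= U by exact: enorm_ge0.
pose S t := dot (P t) (phi t) + dot (Q t) (phi t.-1).
(* The ends, where [phi] vanishes, are included, and any exponent below the distance is allowed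
   since [lam <= 1]. *)
have X t m : (t <= p)%N -> (m <= t - h + (h - t))%N -> enorm (phi t) <= lam ^+ m * U / mu.
  move=> tp mt; case: (ltnP 0 t) => t0; last first.
    have -> : t = 0%N by lia.
    by rewrite phi0 enorm0 divr_ge0 ?mulr_ge0 ?exprn_ge0 ?(ltW mu0).
  have [->|tp'] := eqVneq t p.
    by rewrite phip enorm0 divr_ge0 ?mulr_ge0 ?exprn_ge0 ?(ltW mu0).
  apply: le_trans (green_decay (E := E) (u := D h) mu0 PQ phi0 phip _ lam0 lamE _ _) _.
  - by move=> psi psi0 psip; rewrite phiE // ltnW.
  - by rewrite h1.
  - by rewrite t0 ltn_neqAle tp'.
  - by rewrite -!mulrA ler_wpM2r ?divr_ge0 ?(ltW mu0) // ler_wiXn2l.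
have S_le t a m1 m2 : 0 <= a -> (1 <= t <= p)%N ->
    enorm (P t) * a <= m1 -> enorm (Q t) * a <= m2 ->
    `|S t| * a <= m1 * enorm (phi t) + m2 * enorm (phi t.-1).
  move=> a0 tp Pa Qa.
  apply: le_trans (_ : (enorm (P t) * enorm (phi t) + enorm (Q t) * enorm (phi t.-1)) * a <= _).
    by rewrite ler_wpM2r // (le_trans (ler_normD _ _)) // lerD ?cauchy_schwarz.
  by rewrite mulrDl lerD // mulrAC ler_wpM2r ?enorm_ge0.
(* [B] lifts the boundary data, so that [D - B] is an admissible test sequence for [phi]. *)
pose B := traj p (D 0%N) (D p) (fun=> 0).
have main : dot (D h) (D h) = - \sum_(1 <= t < p.+1) S t *
    (dot (W t) (dw t.-1) + (dot (P t) (B t) + dot (Q t) (B t.-1))).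
  have Bmid t : (1 <= t < p)%N -> B t = 0.
    by rewrite /B /traj => /andP[t1 tp]; rewrite gtn_eqF // ltn_eqF.
  have := phiE (fun t => -1 *: B t + D t); rewrite /= (ltnW hp) (Bmid h) ?h1 // scaler0 add0r.
  have Bp : B p = D p by rewrite /B /traj eqxx gtn_eqF ?(ltnW p2).
  rewrite Bp !scaleN1r !addNr => /(_ erefl erefl isT) <-.
  rewrite energyC (@energy_linear _ _ _ _ _ _ _ (-1) B D) //.
  have /eqP := eqD phi phi0 phip; rewrite addr_eq0 => /eqP ->.
  rewrite /energy [X in _ * (X + _)](_ : _ = 0) ?add0r; last first.
    by rewrite big_nat big1 // => t tp; rewrite Bmid // !dotE; ring.
  rewrite mulN1r -opprD; congr (- _); rewrite -big_split /=.
  by apply: eq_bigr => t _; rewrite /S; ring.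
have {}main : U ^+ 2 <=
    \sum_(1 <= t < p.+1) `|S t| * enorm (W t) * enorm (dw t.-1) +
    (`|S p| * enorm (P p) * enorm (D p) + `|S 1%N| * enorm (Q 1%N) * enorm (D 0%N)).
  (* Only the first and last links see the boundary values. *)
  have -> : `|S p| * enorm (P p) * enorm (D p) + `|S 1%N| * enorm (Q 1%N) * enorm (D 0%N) =
     \sum_(1 <= t < p.+1) `|S t| * (enorm (P t) * enorm (B t) + enorm (Q t) * enorm (B t.-1)).
    under eq_bigr do rewrite mulrDr.
    rewrite big_split /=; congr (_ + _).
      rewrite big_nat_recr ?(ltnW p2) //= big_nat big1 ?add0r; last first.
        move=> t /andP[t1 tp]; rewrite /B /traj gtn_eqF // ltn_eqF //.
        by rewrite enorm0 !mulr0.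
      by rewrite /B /traj eqxx gtn_eqF ?(ltnW p2) // mulrA.
    rewrite big_ltn ?ltnS ?(ltnW p2) //= [X in _ + X]big_nat [X in _ + X]big1 ?addr0.
      by rewrite mulrA.
    move=> t /andP[t2 tp]; rewrite /B /traj gtn_eqF; last by lia.
    by rewrite ltn_eqF; [rewrite enorm0 !mulr0|lia].
  rewrite enorm_sqr main -sumrN -big_split /=; apply: ler_sum_nat => t tp.
  rewrite (le_trans (ler_norm _)) // normrN normrM -mulrA -mulrDr ler_wpM2l //.
  rewrite (le_trans (ler_normD _ _)) // lerD ?cauchy_schwarz //.
  by rewrite (le_trans (ler_normD _ _)) // lerD ?cauchy_schwarz.
set RHS := l / mu * _.
have RHS0 : 0 <= RHS.
  rewrite mulr_ge0 ?divr_ge0 ?(ltW mu0) //.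
  rewrite !addr_ge0 ?mulr_ge0 ?exprn_ge0 ?enorm_ge0 //.
  by apply: sumr_ge0 => t _; rewrite mulr_ge0 ?exprn_ge0 ?enorm_ge0.
have : U ^+ 2 <= RHS * U.
  have -> : RHS * U = \sum_(1 <= t < p.+1)
        l / mu * (lam ^+ (h - t + (t.-1 - h)) * U) * enorm (dw t.-1) +
      (l / mu * (lam ^+ (p - h).-1 * U) * enorm (D p) +
       l / mu * (lam ^+ h.-1 * U) * enorm (D 0%N)).
    rewrite (eq_bigr (fun t => l / mu * U *
      (lam ^+ (h - t + (t.-1 - h)) * enorm (dw t.-1)))); last by move=> t _; ring.
    by rewrite -mulr_sumr /RHS; ring.
  have bnd m : l / mu * (lam ^+ m * U) = l / 2 * (lam ^+ m * U / mu) + l / 2 * (lam ^+ m * U / mu).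
    by field; rewrite gt_eqF.
  have bnd0 m : 0 <= l / 2 * (lam ^+ m * U / mu).
    by rewrite !mulr_ge0 ?exprn_ge0 ?invr_ge0 ?(ltW mu0).
  apply: le_trans main _; apply: lerD; last apply: lerD.
  - apply: ler_sum_nat => t tp; rewrite ler_wpM2r ?enorm_ge0 //.
    apply: le_trans (S_le t _ (l / 2) (l / 2) _ tp _ _) _;
      rewrite ?enorm_ge0 ?enorm_mul_le ?PW ?QW //.
    by rewrite bnd lerD // ler_wpM2l ?divr_ge0 // X //; lia.
  (* At the last link [phi p = 0] removes the [|P p|^2] term and only [|Q p| |P p| <= l/2] remains;
     the first link is symmetric. *)
  - rewrite ler_wpM2r ?enorm_ge0 //.
    apply: le_trans (S_le p _ _ (l / 2) _ _ (lexx _) _) _; rewrite ?enorm_ge0 //.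
    + by rewrite leqnn ltnW.
    + by rewrite mulrC enorm_mul_le ?PQ // leqnn ltnW.
    + rewrite phip enorm0 mulr0 add0r bnd ler_wpDl // ler_wpM2l ?divr_ge0 // X //; lia.
  - rewrite ler_wpM2r ?enorm_ge0 //.
    apply: le_trans (S_le 1%N _ (l / 2) _ _ _ _ (lexx _)) _; rewrite ?enorm_ge0 //.
    + by rewrite (ltnW p2).
    + by rewrite enorm_mul_le ?PQ ?(ltnW p2).
    + rewrite phi0 enorm0 mulr0 addr0 bnd ler_wpDl // ler_wpM2l ?divr_ge0 // X //; lia.
rewrite -/U; have [->//|Un] := eqVneq U 0.
by rewrite expr2 ler_pM2r // lt_def Un.
Qed.

End LinearSensitivity.

(** * First-order optimality in weak form *)

Section Stationarity.
Context {R : realType}.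

Lemma is_derive_big (I : eqType) (s : seq I) (F : I -> R -> R) (F' : I -> R) (x : R) :
  (forall i, i \in s -> is_derive x (1 : R) (F i) (F' i)) ->
  is_derive x (1 : R) (fun y => \sum_(i <- s) F i y) (\sum_(i <- s) F' i).
Proof.
elim: s => [|i s IH] dF.
  rewrite big_nil (_ : (fun y => _) = cst 0); first exact: is_derive_cst.
  by apply/funext => y; rewrite big_nil.
rewrite big_cons (_ : (fun y => _) = F i + (fun y => \sum_(j <- s) F j y)).
  apply: is_deriveD; first by apply: dF; rewrite mem_head.
  by apply: IH => j js; apply: dF; rewrite inE js orbT.
by apply/funext => y; rewrite big_cons.
Qed.

Lemma argmin_stationary (n r p : nat) (f : nat -> 'rV[R]_n -> R)
    (c : nat -> 'rV[R]_(n + n + r) -> R) x0 w xp (y psi : nat -> 'rV[R]_n)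
    (x := traj p x0 xp y) :
  (forall t, (1 <= t <= p)%N -> (forall z, differentiable (f t) z) /\
                                (forall z, differentiable (c t) z)) ->
  is_argmin p f c x0 w xp y -> psi 0%N = 0 -> psi p = 0 ->
  \sum_(1 <= t < p) dot (grad (f t) (x t)) (psi t) +
  \sum_(1 <= t < p.+1)
    dot (grad (c t) (row_mx (row_mx (x t) (x t.-1)) (w t.-1)))
        (row_mx (row_mx (psi t) (psi t.-1)) 0) = 0.
Proof.
move=> diff_fc ymin psi0 psip.
pose z t := row_mx (row_mx (x t) (x t.-1)) (w t.-1).
(* The variation moves the interior states only, so its disturbance block is zero. *)
pose zeta t : 'rV[R]_(n + n + r) := row_mx (row_mx (psi t) (psi t.-1)) 0.
pose F : R -> R := (fun s : R => \sum_(1 <= t < p) f t (x t + s *: psi t)) +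
  (fun s : R => \sum_(1 <= t < p.+1) c t (z t + s *: zeta t)).
have FE s : F s = objective p f c x0 w xp (fun t => y t + s *: psi t).
  have trajE t : traj p x0 xp (fun t => y t + s *: psi t) t = x t + s *: psi t.
    rewrite /x /traj; case: eqP => [->|_]; first by rewrite psi0 scaler0 addr0.
    by case: eqP => [->|_] //; rewrite psip scaler0 addr0.
  rewrite /F /objective fctE; congr (_ + _); apply: eq_bigr => t _; rewrite !trajE //.
  by rewrite /z /zeta !scale_row_mx !add_row_mx scaler0 addr0.
pose F' (s : R) := \sum_(1 <= t < p) dot (grad (f t) (x t + s *: psi t)) (psi t) +
  \sum_(1 <= t < p.+1) dot (grad (c t) (z t + s *: zeta t)) (zeta t).
have dF s : is_derive s (1 : R) F (F' s).
  by apply: is_deriveD; apply: is_derive_big => t; rewrite mem_index_iota => tp;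
    apply: is_derive_line; apply (diff_fc t); lia.
have y0 : (fun t => y t + 0 *: psi t) = y.
  by apply/funext => t; rewrite scale0r addr0.
transitivity (F' 0); last by apply: (is_derive_min dF) => s; rewrite !FE y0; exact: ymin.
have xE t : x t + 0 *: psi t = x t by rewrite scale0r addr0.
have zE t : z t + 0 *: zeta t = z t by rewrite scale0r addr0.
by rewrite /F'; apply: f_equal2; apply: eq_bigr => t _; rewrite (xE, zE); reflexivity.
Qed.

End Stationarity.

(** * The rate, and the assembly of the estimate *)

Lemma contraction_rate {R : realType} (mu l : R) (q := Num.sqrt (1 + 2 * l / mu))
    (lam := 1 - 2 / (q + 1)) : 0 < mu -> 0 <= l ->
  0 <= lam <= 1 /\ l / 2 * (1 - lam) ^+ 2 = mu * lam.
Proof.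
move=> mu0 l0.
have k1 : 1 <= 1 + 2 * l / mu.
  by rewrite lerDl mulr_ge0 ?mulr_ge0 ?invr_ge0 ?(ltW mu0).
have q1 : 1 <= q by rewrite -sqrtr1 ler_sqrt // (le_trans ler01).
have qq : q ^+ 2 = 1 + 2 * l / mu by rewrite sqr_sqrtr // (le_trans ler01).
(* In terms of [q], [lam = (q - 1) / (q + 1)] and both sides of the equation equal
   [mu (q - 1) / (q + 1)]. *)
have lE : l = mu * (q ^+ 2 - 1) / 2 by rewrite qq; field; rewrite gt_eqF.
have qp : 0 < q + 1 by clear -q1; lra.
split.
  rewrite /lam subr_ge0 ler_pdivrMr // mul1r gerBl divr_ge0 ?(ltW qp) // andbT.
  by clear -q1; lra.
by rewrite /lam lE; field; rewrite gt_eqF.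
Qed.

Theorem theorem1 (R : realType) (n r p : nat) (mu l : R)
  (f : nat -> 'rV[R]_n -> R) (c : nat -> 'rV[R]_(n + n + r) -> R) :
  (2 <= p)%N -> 0 < mu ->
  (forall t, (1 <= t <= p)%N ->
     [/\ strongly_convex mu (f t), C2 (f t),
         convex_fun (c t), strongly_smooth l (c t) & C2 (c t)]) ->
  forall (x0 x0' xp xp' : 'rV[R]_n) (w w' : nat -> 'rV[R]_r)
         (y y' : nat -> 'rV[R]_n),
  is_argmin p f c x0 w xp y -> is_argmin p f c x0' w' xp' y' ->
  let C0 := 2 * l / mu in
  let lam0 := 1 - 2 / (Num.sqrt (1 + 2 * l / mu) + 1) in
  forall h : nat, (1 <= h <= p.-1)%N ->
  enorm (y h - y' h) <=
    C0 * (lam0 ^+ h.-1 * enorm (x0 - x0')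
          + \sum_(0 <= t < p)
              lam0 ^ ((`|h%:Z - t%:Z|%N)%:Z - 1) * enorm (w t - w' t)
          + lam0 ^+ (p - h).-1 * enorm (xp - xp')).
Proof.
move=> p2 mu0 fc x0 x0' xp xp' w w' y y' ymin ymin' C0 lam0 h /andP[h1 hp].
have diff_fc t : (1 <= t <= p)%N -> (forall z, differentiable (f t) z) /\
                                    (forall z, differentiable (c t) z).
  by move=> /fc[_ [df _] _ _ [dc _]].
(* A negative [l] makes the spaces of states and of disturbances trivial, and both sides vanish. *)
have [l0|l0] := ltP l 0.
  have t1 : (1 <= 1 <= p)%N by rewrite (ltnW p2).
  have [_ _ cvx smooth _] := fc _ t1; have [_ dc] := diff_fc _ t1.
  have zero x v : enorm (row_mx (row_mx x (0 : 'rV[R]_n)) v : 'rV[R]_(n + n + r)) = 0.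
    exact: neg_smooth_enorm0 dc l0 cvx smooth.
  have zerox x : enorm (x : 'rV[R]_n) = 0.
    by rewrite -(zero x 0) !enormE !dot_row_mx !dot0l !addr0.
  have zerov v : enorm (v : 'rV[R]_r) = 0.
    by rewrite -(zero 0 v) !enormE !dot_row_mx !dot0l !add0r.
  rewrite !zerox big1 ?mulr0 ?addr0 ?mulr0 // => t _.
  by rewrite zerov mulr0.
have [lam01 lamE] := contraction_rate mu0 l0; rewrite -/lam0 in lam01 lamE.
have /andP[lam_ge0 lam_le1] := lam01.
pose x := traj p x0 xp y; pose x' := traj p x0' xp' y'.
pose z t := row_mx (row_mx (x t) (x t.-1)) (w t.-1).
pose z' t := row_mx (row_mx (x' t) (x' t.-1)) (w' t.-1).
pose D t := x t - x' t; pose dw t := w t - w' t.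
pose a t := grad (f t) (x t) - grad (f t) (x' t).
pose g t := grad (c t) (z t) - grad (c t) (z' t).
pose E t := rank1 (a t - mu *: D t) (D t).
pose G t := rank1 (g t) (z t - z' t).
(* The blocks of [G t] face the current state, the previous state and the disturbance. *)
pose P t := lsubmx (lsubmx (G t)); pose Q t := rsubmx (lsubmx (G t)).
pose W t := rsubmx (G t).
have zz t : z t - z' t = row_mx (row_mx (D t) (D t.-1)) (dw t.-1).
  by rewrite /z /z' /D /dw !opp_row_mx !add_row_mx.
have GE t : G t = row_mx (row_mx (P t) (Q t)) (W t) by rewrite !hsubmxK.
have coco t : (1 <= t <= p)%N -> dot (g t) (g t) <= l * dot (g t) (z t - z' t).
  move=> tp; have [_ dc] := diff_fc t tp; have [_ _ cvx smooth _] := fc t tp.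
  exact: cocoercive.
have g_ge0 t : (1 <= t <= p)%N -> 0 <= dot (g t) (z t - z' t).
  move=> /coco; move: l0; rewrite le_eqVlt => /predU1P[<-|l_gt0].
    by rewrite mul0r => H; rewrite (@dot_eq0 _ _ (g t)) ?dot0l //; apply/le_anti; rewrite H dot_ge0.
  by move=> /(le_trans (dot_ge0 _)); rewrite pmulr_rge0.
have g0 t : (1 <= t <= p)%N -> dot (g t) (z t - z' t) = 0 -> g t = 0.
  by move=> /coco /[swap] ->; rewrite mulr0 => H; apply/dot_eq0/le_anti; rewrite H dot_ge0.
have bound t : (1 <= t <= p)%N ->
    dot (P t) (P t) + dot (Q t) (Q t) + dot (W t) (W t) <= l.
  by move=> tp; rewrite -!dot_row_mx -GE rank1_le ?coco ?g_ge0.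
have aE t v : (1 <= t <= p)%N ->
    dot (a t) v = mu * dot (D t) v + dot (E t) (D t) * dot (E t) v.
  move=> tp; have [cvx [df _] _ _ _] := fc t tp.
  have [e0 e00] := strongly_convex_grad (x t) (x' t) df mu0 cvx.
  by rewrite -!dotZl -dotDl (rank1_dot e0 e00) addrC subrK.
have gE t v v' : (1 <= t <= p)%N -> dot (g t) (row_mx (row_mx v v') 0) =
    (dot (P t) (D t) + dot (Q t) (D t.-1) + dot (W t) (dw t.-1)) *
    (dot (P t) v + dot (Q t) v').
  move=> tp; rewrite -(rank1_dot (g_ge0 _ tp) (g0 _ tp)) dotZl -/(G t).
  by rewrite zz GE !dot_row_mx dot0r addr0.
have eqD psi : psi 0%N = 0 -> psi p = 0 ->
    energy p mu E P Q D psi +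
     \sum_(1 <= t < p.+1) dot (W t) (dw t.-1) *
       (dot (P t) (psi t) + dot (Q t) (psi t.-1)) = 0.
  move=> psi0 psip.
  (* The system for [D] is the difference of the two stationarity conditions. *)
  have := argmin_stationary diff_fc ymin psi0 psip.
  have := argmin_stationary diff_fc ymin' psi0 psip.
  rewrite -/x -/x' => H' H; move: (f_equal2 (fun a b => a - b) H H'); cbv beta.
  rewrite subr0 opprD.
  rewrite addrACA.
  rewrite -!sumrB.
  move=> {H'}H.
  rewrite -[RHS]H.
  rewrite /energy -addrA -big_split /=; apply: f_equal2; apply: eq_big_nat => t tp.
    rewrite -aE; [exact: dotBl|lia].
  rewrite -dotBl gE //; ring.
have hp' : (h < p)%N by lia.
have Dh : D h = y h - y' h by rewrite /D /x /x' /traj gtn_eqF // ltn_eqF.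
have Dp : D p = xp - xp' by rewrite /D /x /x' /traj eqxx gtn_eqF // ltnW.
have H := linear_sensitivity mu0 lam01 lamE bound eqD (introT andP (conj h1 hp')).
rewrite -Dh -Dp; apply: le_trans H _; rewrite big_add1 /=.
(* For [l = 0] both constants vanish; otherwise [lam0 > 0], which the exponent [-1] at [t = h]
   requires. *)
move: l0; rewrite le_eqVlt => /predU1P[l0|l_gt0].
  by rewrite /C0 -l0 mulr0 !mul0r.
have lam_gt0 : 0 < lam0.
  rewrite lt_def lam_ge0 andbT; apply/eqP => lam_eq0; move: lamE.
  by rewrite lam_eq0 subr0 expr1n !mulr1 mulr0 => /eqP; rewrite gt_eqF ?divr_gt0.
(* Disturbance [t] sits on link [t.+1]. The exponents agree for [t < h]; for [t >= h] the link
   exponent is one larger, so its power is at most the stated one. *)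
have sum_le : \sum_(0 <= t < p) lam0 ^+ (h - t.+1 + (t - h)) * enorm (dw t) <=
    \sum_(0 <= t < p) lam0 ^ ((`|h%:Z - t%:Z|%N)%:Z - 1) * enorm (w t - w' t).
  apply: ler_sum => t _; rewrite ler_wpM2r ?enorm_ge0 //.
  have [th|th|<-] := ltngtP t h.
  - have -> : ((`|h%:Z - t%:Z|%N)%:Z - 1 = (h - t.+1 + (t - h))%N :> int)%R by lia.
    by [].
  - have -> : ((`|h%:Z - t%:Z|%N)%:Z - 1 = (t - h).-1%N :> int)%R by lia.
    by rewrite -exprnP ler_wiXn2l //; lia.
  - have -> : ((`|t%:Z - t%:Z|%N)%:Z - 1 = - 1%:Z)%R by lia.
    have -> : (t - t.+1 + (t - t) = 0)%N by lia.
    by rewrite expr0 exprN1 invf_ge1.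
have : 0 <= \sum_(0 <= t < p) lam0 ^+ (h - t.+1 + (t - h)) * enorm (dw t).
  by apply: sumr_ge0 => t _; rewrite mulr_ge0 ?exprn_ge0 ?enorm_ge0.
have lmu : 0 <= l / mu by rewrite divr_ge0 ?ltW.
have A0 : 0 <= lam0 ^+ h.-1 * enorm (x0 - x0') by rewrite mulr_ge0 ?exprn_ge0 ?enorm_ge0.
have B0 : 0 <= lam0 ^+ (p - h).-1 * enorm (D p) by rewrite mulr_ge0 ?exprn_ge0 ?enorm_ge0.
have -> : C0 = l / mu * 2 by rewrite /C0; ring.
rewrite -[D 0%N]/(x0 - x0') -(mulrA (l / mu)) => S0; rewrite ler_wpM2l //.
move: A0 B0 S0 sum_le; move: (_ * enorm (x0 - x0')) (_ * enorm (D p)) (\sum_(_ <= _ < _) _)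
  (\sum_(_ <= _ < _) _) => A B S' S; clear; lra.
Qed.
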